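(* Let $n\to\infty$ and let $d=d(n)$ and $\ell=\ell(n)$ be integers with $d\mid n$, $d=o(n/\log n)$ and $\ell<d/2$. Set $k=n/d$. Pick a uniformly random $d$-linear form $f:(\mathbb{F}_2^k)^d\to\mathbb{F}_2$, viewed as a function on $\mathbb{F}_2^{n}=(\mathbb{F}_2^k)^d$. Then with probability $1-o(1)$, $f$ has the following property: for every polynomial $P(X_1,\dots,X_n)\in\mathbb{F}_2[X_1,\dots,X_n]$ of degree at most $\ell$, $$\mathrm{Corr}(f,P)<2^{-(1-o(1))n/d}.$$ (Here the $o(1)$ terms tend to $0$ as $n\to\infty$.)
   Context: A $d$-linear form $f:(\mathbb{F}_2^k)^d\to\mathbb{F}_2$ is a map that is $\mathbb{F}_2$-linear in each of its $d$ arguments; equivalently $f(x_1,\dots,x_d)=\sum_{(i_1,\dots,i_d)\in[k]^d}T(i_1,\dots,i_d)\,x_{1,i_1}\cdots x_{d,i_d}$ for a tensor $T:[k]^d\to\mathbb{F}_2$; a uniformly random $d$-linear form means all entries of $T$ are independent uniform bits. For $g:\mathbb{F}_2^n\to\mathbb{F}_2$, $\mathrm{bias}(g)=\left|\mathbb{E}_{x\in\mathbb{F}_2^n}(-1)^{g(x)}\right|$, and $\mathrm{Corr}(f,g)=\mathrm{bias}(f-g)$. *)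

(* Defs.v *)
From HB Require Import structures.
From mathcomp Require Import all_boot all_order all_algebra.
From mathcomp Require Import all_classical all_reals all_analysis.
(* The notations of [mpoly] are not imported: they clash with those of
   MathComp-Analysis, hence the qualified names below. *)
From mathcomp Require Import (canonicals, coercions) mpoly.

Set Implicit Arguments.
Unset Strict Implicit.
Unset Printing Implicit Defensive.

Import Order.TTheory GRing.Theory Num.Theory.
Import numFieldNormedType.Exports.
Local Open Scope ring_scope.

Lemma block_index_subproof (n d : nat) (a : 'I_d) (j : 'I_(n %/ d)) :
  (a * (n %/ d) + j < n)%N.
Proof.
apply: (@leq_trans (a.+1 * (n %/ d))); first by rewrite mulSnr ltn_add2l.
apply: (@leq_trans (d * (n %/ d))); first by rewrite leq_mul2r ltn_ord orbT.
by rewrite mulnC leq_divM.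
Qed.

Definition block_index (n d : nat) (a : 'I_d) (j : 'I_(n %/ d)) : 'I_n :=
  Ordinal (block_index_subproof a j).

(* The identification F_2^n = (F_2^k)^d, where k = n / d: [block x a] is the
   component x_a of x. It is a bijection when d divides n. *)
Definition block (n d : nat) (x : 'rV['F_2]_n) (a : 'I_d) :
    'rV['F_2]_(n %/ d) :=
  \row_(j < n %/ d) x 0 (block_index a j).

(* A multi-index (i_1, ..., i_d) in [k]^d is a function 'I_d -> 'I_k. *)
Definition tensor (k d : nat) : finType :=
  {ffun {ffun 'I_d -> 'I_k} -> 'F_2}.

Definition mlform (k d : nat) (T : tensor k d) (x : 'I_d -> 'rV['F_2]_k) :
    'F_2 :=
  \sum_(i : {ffun 'I_d -> 'I_k}) T i * \prod_(a < d) x a 0 (i a).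

Definition mlform_fun (n d : nat) (T : tensor (n %/ d) d) (x : 'rV['F_2]_n) :
    'F_2 :=
  mlform T (fun a => block x a).

Definition poly_fun (n : nat) (P : mpoly.mpoly n 'F_2) (x : 'rV['F_2]_n) :
    'F_2 :=
  mpoly.meval (fun i => x 0 i) P.

(* [mpoly.msize P] is 1 + the total degree of P, and 0 for P = 0. *)
Definition degree_le (n l : nat) (P : mpoly.mpoly n 'F_2) : Prop :=
  (mpoly.msize P <= l.+1)%N.

Definition bias (R : realType) (n : nat) (g : 'rV['F_2]_n -> 'F_2) : R :=
  `| (\sum_(x : 'rV['F_2]_n) (-1) ^+ (g x : nat)) / #|{: 'rV['F_2]_n}|%:R |.

Definition Corr (R : realType) (n : nat) (f g : 'rV['F_2]_n -> 'F_2) : R :=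
  bias R (fun x => f x - g x).

(* The probability of E under the uniform distribution on [Omega]; for
   [Omega = tensor k d] the entries are then independent uniform bits. *)
Definition Pr_unif (R : realType) (Omega : finType) (E : Omega -> Prop) : R :=
  #|[pred w : Omega | `[< E w >]]|%:R / #|Omega|%:R.

(* Main.v *)
Require Import Defs.
From HB Require Import structures.
From mathcomp Require Import all_boot all_order all_algebra finfield.
From mathcomp Require Import all_classical all_reals all_analysis.
From mathcomp Require Import (canonicals, coercions) mpoly.
From mathcomp Require Import zify ring lra.
Import Order.TTheory GRing.Theory Num.Theory.
Import numFieldNormedType.Exports.

(* Write k = n / d, fix a function g on F_2^n, and let b_T be the sum over x of
   (-1)^(f_T(x) - g(x)). Expanding the t-th power and averaging over T gives
     E_T b_T^t <= #{(x^1, ..., x^t) : sum_i x^i_1 (x) ... (x) x^i_d = 0}.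
   Let y^i be the product of all factors of the i-th tensor but the first. Given
   the y^i, only one choice of the first factor is possible each time y^i lies
   outside the span of the previous ones, so the count is at most B^t, where
   B / 2^n = 2^-k + max_U Pr[y in U] over subspaces U of dimension < t.
   If dim U < q^m, then a random rank one tensor of order m is in U with
   probability at most m 2^(q - k): the vectors x whose slice {z : x (x) z in U}
   has dimension >= q^(m-1) span a space of dimension < q, because the slices of
   independent vectors are in direct sum, and the other x are handled by
   induction on m. With t = q^(d-1), where q = o(k), 2^q >= d and q^2 >= 16 k,
   Markov's inequality beats the union bound over polynomials of degree l < d/2:
   these are determined by at most 4^d k^l <= q^d bits. *)

Set Implicit Arguments.
Unset Strict Implicit.
Unset Printing Implicit Defensive.
Local Open Scope ring_scope.
Local Notation F2 := 'F_2.

(** * Slices of a subspace of tensors *)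

Section Tensor.
Variables (F : fieldType) (k : nat) (V : vectType F).

Definition tens (x : 'rV[F]_k) (v : V) : {ffun 'I_k -> V} :=
  [ffun i => x 0 i *: v].

Lemma tens_linear x : linear (tens x).
Proof.
move=> a u v; apply/ffunP => i; rewrite !ffunE /= scalerDr !scalerA.
by rewrite mulrC.
Qed.

HB.instance Definition _ x :=
  GRing.isLinear.Build F V {ffun 'I_k -> V} _ (tens x) (tens_linear x).

Definition slice (U : {vspace {ffun 'I_k -> V}}) (x : 'rV[F]_k) : {vspace V} :=
  (linfun (tens x) @^-1: U)%VS.

Lemma mem_slice U x v : (v \in slice U x) = (tens x v \in U).
Proof. by rewrite -memv_preim lfunE. Qed.

(** Each coordinate functional of [V] turns the relation into a linear relation among the vectors of
    [X], which freeness forces to be trivial. *)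
Lemma tens_free_eq0 n (X : n.-tuple 'rV[F]_k) (v : 'I_n -> V) : free X ->
  \sum_(i < n) tens X`_i (v i) = 0 -> forall i, v i = 0.
Proof.
move=> /freeP freeX sum0 i; rewrite (coord_vbasis (memvf (v i))) big1 // => c _.
suff /(_ i)-> : forall i, coord (vbasis fullv) c (v i) = 0 by rewrite scale0r.
apply: freeX; apply/rowP => j; have /ffunP/(_ j) := sum0.
rewrite sum_ffunE !ffunE => /(congr1 (coord (vbasis fullv) c)).
rewrite linear0 linear_sum => sumj; rewrite summxE [RHS]mxE -[RHS]sumj.
by apply: eq_bigr => a _; rewrite mxE ffunE linearZ /= mulrC.
Qed.

(** Tensoring with a nonzero vector is injective, so each slice embeds in [U]; by [tens_free_eq0]
    the images are in direct sum. *)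
Lemma sum_dim_slice n (X : n.-tuple 'rV[F]_k) U : free X ->
  (\sum_(i < n) \dim (slice U X`_i) <= \dim U)%N.
Proof.
move=> freeX; pose W (i : 'I_n) := (linfun (tens X`_i) @: slice U X`_i)%VS.
have dimW (i : 'I_n) : \dim (slice U X`_i) = \dim (W i).
  apply/esym/limg_dim_eq/eqP; rewrite -subv0; apply/subvP => v.
  rewrite memv_cap memv_ker lfunE memv0 => /andP[_ /eqP v0].
  pose u (j : 'I_n) := if j == i then v else 0.
  have := @tens_free_eq0 n X u freeX _ i; rewrite /u eqxx => -> //.
  rewrite (bigD1 i) //= eqxx v0 big1 ?addr0 // => j /negPf->.
  by rewrite linear0.
have : directv (\sum_(i < n) W i).
  apply/directv_sum_independent => w Ww sum0 i _.
  pose v (j : 'I_n) := ((linfun (tens X`_j))^-1)%VF (w j).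
  have wE j : w j = tens X`_j (v j).
    rewrite -[RHS]lfunE limg_lfunVK //; apply: subvP (Ww j isT).
    exact/limgS/subvf.
  rewrite wE (@tens_free_eq0 n X v) ?linear0 //.
  by rewrite -[RHS]sum0; apply: eq_bigr => j _; rewrite wE.
move=> /directvP /= dW; rewrite (eq_bigr _ (fun i _ => dimW i)) -dW.
apply/dimvS/subv_sumP => i _; apply/subvP => _ /memv_imgP[v + ->].
by rewrite mem_slice lfunE.
Qed.

End Tensor.

Lemma free_subset_span (F : fieldType) (V : vectType F) (B : seq V) :
  {X : seq V | [/\ free X, {subset X <= B} & {subset B <= <<X>>%VS}]}.
Proof.
elim: B => [|b B [X [freeX XB BX]]].
  by exists [::]; split=> //; rewrite nil_free.
have [bX|bX] := boolP (b \in <<X>>%VS).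
  exists X; split=> // [x /XB xB|x]; first by rewrite inE xB orbT.
  by rewrite inE => /predU1P[->|/BX].
exists (b :: X); split; first by rewrite free_cons bX.
  by move=> x; rewrite !inE => /predU1P[->|/XB->]; rewrite ?eqxx ?orbT.
move=> x; rewrite span_cons inE => /predU1P[->|/BX xX].
  by rewrite (subvP (addvSl _ _)) ?memv_line.
by rewrite (subvP (addvSr _ _)).
Qed.

(** A free family of such vectors has fewer than [q] members by [sum_dim_slice]; a maximal one spans
    them all, and its span over F_2 is small. *)
Lemma few_large_slices k (V : vectType F2) (U : {vspace {ffun 'I_k -> V}}) q s :
  (\dim U < q * s)%N ->
  (#|[pred x : 'rV[F2]_k | s <= \dim (slice U x)]| <= 2 ^ q)%N.
Proof.
move=> ltU; set B := [pred x | _].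
have [X [freeX XB BX]] := free_subset_span (enum B).
have szX : (size X < q)%N.
  have s_gt0 : (0 < s)%N by case: s ltU {B XB BX} => //; rewrite muln0.
  rewrite -(ltn_pmul2r s_gt0); apply: leq_ltn_trans ltU.
  apply: leq_trans (sum_dim_slice (X := in_tuple X) U freeX).
  rewrite -[X in (X * s)%N]card_ord -sum_nat_const; apply: leq_sum => i _.
  have /XB : X`_i \in X by rewrite mem_nth.
  by rewrite mem_enum.
apply: (@leq_trans #|<<X>>%VS|).
  by apply/subset_leq_card/fintype.subsetP => x Bx; apply: BX; rewrite mem_enum.
by rewrite card_vspace card_Fp // (eqP freeX) leq_exp2l // ltnW.
Qed.

(** * Rank one tensors in a subspace of small dimension *)

Section IteratedTensor.
Variable k : nat.

Fixpoint tensors m : vectType F2 :=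
  if m is m'.+1 then {ffun 'I_k -> tensors m'} : vectType F2
  else F2^o : vectType F2.

Fixpoint vectuple m : finType :=
  if m is m'.+1 then ('rV[F2]_k * vectuple m')%type : finType
  else unit : finType.

Fixpoint rank_one m : vectuple m -> tensors m :=
  if m is m'.+1 then fun u => tens u.1 (rank_one u.2) else fun=> 1.

Lemma card_vectuple m : #|vectuple m| = (2 ^ (k * m))%N.
Proof.
elim: m => [|m IH]; first by rewrite card_unit muln0.
by rewrite /= card_prod IH card_mx card_Fp // mul1n mulnS expnD.
Qed.

(** The probability bound m 2^(q - k) with denominators cleared. Splitting on the first factor, the
    at most 2^q vectors with a large slice cost one extra 2^q; the others fall under the induction
    hypothesis. *)
Lemma few_rank_one_in m q (U : {vspace tensors m}) : (\dim U < q ^ m)%N ->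
  (#|[pred u | rank_one u \in U]| * 2 ^ k <= m * 2 ^ q * 2 ^ (k * m))%N.
Proof.
elim: m U => [|m IH] U ltU.
  (* For m = 0 the hypothesis reads \dim U < 1, so [U] cannot contain the scalar 1, the only value
     of [rank_one]. *)
  rewrite mul0n leqn0 muln_eq0 -leqn0 leqNgt; apply/orP; left; apply/negP.
  case/card_gt0P => u U1; have {}U1 : (1 : F2^o) \in U := U1.
  have : (\dim <[1 : F2^o]>%VS <= \dim U)%N by apply/dimvS; rewrite -memvE.
  by rewrite dim_vline oner_eq0; case: (\dim U) ltU.
set B := [pred x : 'rV[F2]_k | (q ^ m <= \dim (slice U x))%N].
have leB : (#|B| <= 2 ^ q)%N by apply: few_large_slices; rewrite -expnS.
have -> : #|[pred u : vectuple m.+1 | rank_one u \in U]| =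
    (\sum_(x : 'rV[F2]_k)
       #|[pred u : vectuple m | rank_one u \in slice U x]|)%N.
  rewrite -sum1_card (eq_bigr (fun x =>
    \sum_(u : vectuple m | rank_one u \in slice U x) 1)%N).
    rewrite pair_big_dep; apply: eq_bigl => -[x u].
    by rewrite !inE /= mem_slice.
  by move=> x _; rewrite sum1_card.
rewrite (bigID B) /= mulnDl !mulSn mulnDl leq_add //.
  rewrite mulnS addnC expnD mulnA leq_mul2r; apply/orP; right.
  apply: (@leq_trans (\sum_(x : 'rV[F2]_k | x \in B) 2 ^ (k * m))).
    by apply: leq_sum => x _; rewrite -card_vectuple max_card.
  by rewrite sum_nat_const leq_mul2r leB orbT.
rewrite big_distrl /=.
apply: (@leq_trans (\sum_(x : 'rV[F2]_k | x \notin B) m * 2 ^ q * 2 ^ (k * m))).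
  by apply: leq_sum => x; rewrite -ltnNge => /IH.
rewrite sum_nat_const mulnS expnD [leqRHS]mulnCA leq_mul //.
by rewrite (leq_trans (max_card _)) // card_mx card_Fp // mul1n.
Qed.

End IteratedTensor.

(** * Counting tuples of rank one tensors with a prescribed sum *)

Section Hits.
Variables k m : nat.
Implicit Types (w : {ffun 'I_k -> tensors k m}) (U : {vspace tensors k m}).

(* The number of t-tuples of rank one tensors whose sum s satisfies
   w + s \in (F_2^k) (x) U. *)
Fixpoint hits t w U : nat :=
  if t is t'.+1
  then (\sum_(u : 'rV[F2]_k * vectuple k m)
          hits t' (w + tens u.1 (rank_one u.2))%R U)%N
  else [forall j, w j \in U].

(** Summing over the first factor is paid for by one more dimension of [U]. At t = 0, two different
    solutions x would put a nonzero multiple of [y] in [U], and one solution already puts every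
    [w j] in U + <y>. *)
Lemma sum_hits_tens t w U y : y \notin U ->
  (\sum_(x : 'rV[F2]_k) hits t (w + tens x y)%R U <=
     hits t w (U + <[y]>)%VS)%N.
Proof.
move=> yNU; elim: t w => [|t IH] w /=; last first.
  rewrite exchange_big; apply: leq_sum => u _; apply: leq_trans (IH _).
  by apply: leq_sum => x _; rewrite addrAC.
have wE x j : (w + tens x y) j = w j + x 0 j *: y by rewrite !ffunE.
rewrite -big_mkcond sum1_card /=; set E := (X in #|X|).
have E_le1 : (#|E| <= 1)%N.
  apply/card_le1_eqP => x x' /forallP Ex /forallP Ex'.
  apply/rowP => j; apply/eqP; rewrite -subr_eq0; apply: contraNT yNU => nz.
  have := memvB (Ex' j) (Ex j); rewrite !wE opprD addrACA subrr add0r.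
  by rewrite -scalerBl rpredZeq (negPf nz).
have [->//|/card_gt0P[x]] := posnP #|E|; move/forallP => Ex.
suff -> : [forall j, w j \in (U + <[y]>)%VS] by [].
apply/forallP => j; rewrite -(addrK (x 0 j *: y) (w j)) -wE memv_add //.
by rewrite memvN memvZ ?memv_line.
Qed.

(** Of the factor m + 1, the m counts tails in [U], with all 2^k first factors allowed, and the 1
    counts tails outside [U], handled by [sum_hits_tens]. The hypothesis is an invariant: t drops by
    one when \dim U grows by at most one. *)
Lemma hits_le q t w U : (\dim U + t <= q ^ m)%N ->
  (hits t w U <= (m.+1 * 2 ^ q * 2 ^ (k * m)) ^ t)%N.
Proof.
elim: t w U => [|t IH] w U ht; first by rewrite expn0 leq_b1.
set B := (_ * _)%N; rewrite -/B in IH.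
rewrite /= -(pair_bigA _ (fun x v => hits t (w + tens x (rank_one v)) U)) /=.
rewrite exchange_big (bigID (fun v => rank_one v \in U)) /=.
rewrite expnS {1}/B mulSn !mulnDl [leqRHS]addnC leq_add //.
  apply: (@leq_trans
      (\sum_(v : vectuple k m | rank_one v \in U) 2 ^ k * B ^ t)).
    apply: leq_sum => v _; apply: (@leq_trans (\sum_(x : 'rV[F2]_k) B ^ t)).
      by apply: leq_sum => x _; apply: IH; lia.
    by rewrite sum_nat_const card_mx card_Fp // mul1n.
  rewrite sum_nat_const mulnA leq_mul2r few_rank_one_in ?orbT //; lia.
apply: (@leq_trans (\sum_(v : vectuple k m | rank_one v \notin U) B ^ t)).
  apply: leq_sum => v vNU; apply: leq_trans (sum_hits_tens _ _ vNU) (IH _ _ _).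
  apply: leq_trans ht; rewrite -addSnnS leq_add2r -[(\dim U).+1]addn1.
  apply: leq_trans (dimv_add_leqif _ _) _.
  by rewrite leq_add2l dim_vline leq_b1.
rewrite sum_nat_const leq_mul2r; apply/orP; right.
apply: leq_trans (max_card _) _; rewrite card_vectuple -[leqLHS]mul1n leq_mul2r.
by rewrite expn_gt0 orbT.
Qed.

End Hits.

(** * Tensors in coordinates, and multilinear forms as functionals on them *)

Section Coordinates.
Variable k : nat.

(* Multi-indices are functions on nat, of which only the first m values count. *)
Fixpoint coords m : tensors k m -> (nat -> 'I_k) -> F2 :=
  if m is m'.+1 then fun w g => coords (w (g 0)) (fun a => g a.+1)
  else fun w _ => w.

Lemma coordsD m (v w : tensors k m) g :
  coords (v + w) g = coords v g + coords w g.
Proof. by elim: m v w g => [//|m IH] v w g /=; rewrite ffunE IH. Qed.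

Lemma coordsZ m a (v : tensors k m) g : coords (a *: v) g = a * coords v g.
Proof. by elim: m v g => [//|m IH] v g /=; rewrite ffunE IH. Qed.

Lemma coords_eq0 m (w : tensors k m) :
  (0 < k)%N -> (forall g, coords w g = 0) -> w = 0.
Proof.
move=> k_gt0; elim: m w => [|m IH] w w0.
  exact: (w0 (fun=> Ordinal k_gt0)).
apply/ffunP => j; rewrite ffunE; apply: IH => g.
exact: (w0 (fun a => if a is a'.+1 then g a' else j)).
Qed.

Lemma eq_coords m (w : tensors k m) g h :
  (forall a, (a < m)%N -> g a = h a) -> coords w g = coords w h.
Proof.
elim: m w g h => [//|m IH] w g h gh /=; rewrite gh //.
by apply: IH => a am; apply: gh.
Qed.

Fixpoint pack m (f : nat -> 'rV[F2]_k) : vectuple k m :=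
  if m is m'.+1 then (f 0%N, pack m' (fun a => f a.+1)) else tt.

Lemma pack_inj m f g : pack m f = pack m g -> forall a, (a < m)%N -> f a = g a.
Proof.
elim: m f g => [//|m IH] f g /= [fg0 fg] [//|a] am.
exact: (IH (fun a => f a.+1) (fun a => g a.+1)).
Qed.

Lemma coords_rank_one m f g :
  coords (rank_one (pack m f)) g = \prod_(a < m) f a 0 (g a).
Proof.
elim: m f g => [|m IH] f g /=; first by rewrite big_ord0.
by rewrite ffunE coordsZ IH big_ord_recl.
Qed.

(** The linear functional on tensors whose value at a rank one tensor is the multilinear form with
    coefficients [T]. *)
Definition pairing m (T : {ffun {ffun 'I_m.+1 -> 'I_k} -> F2})
    (w : tensors k m.+1) : F2 :=
  \sum_i T i * coords w (fun a => i (inord a)).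

Lemma pairingDl m (T T' : {ffun {ffun 'I_m.+1 -> 'I_k} -> F2}) w :
  pairing (T + T') w = pairing T w + pairing T' w.
Proof. by rewrite -big_split; apply: eq_bigr => i _; rewrite ffunE mulrDl. Qed.

Lemma pairingDr m (T : {ffun {ffun 'I_m.+1 -> 'I_k} -> F2}) v w :
  pairing T (v + w) = pairing T v + pairing T w.
Proof. by rewrite -big_split; apply: eq_bigr => i _; rewrite coordsD mulrDr. Qed.

Lemma pairing0r m (T : {ffun {ffun 'I_m.+1 -> 'I_k} -> F2}) : pairing T 0 = 0.
Proof. by apply: (addrI (pairing T 0)); rewrite -pairingDr !addr0. Qed.

End Coordinates.

(** * Moments of the signed sums over a random form *)

Section Moments.
Variable R : numDomainType.

Definition signF2 (b : F2) : R := (-1) ^+ (b : nat).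

Lemma F2_cases (b : F2) : b = 0 \/ b = 1.
Proof. by case: b => [[|[|//]] ?]; [left|right]; apply/val_inj. Qed.

Lemma signF2D (a b : F2) : signF2 (a + b) = signF2 a * signF2 b.
Proof.
case: (F2_cases a) (F2_cases b) => -> [] ->; rewrite /signF2 /= ?expr0 ?expr1;
by rewrite ?mul1r ?mulr1 ?mulrNN ?mulr1.
Qed.

Lemma signF2N (a : F2) : signF2 (- a) = signF2 a.
Proof. by case: (F2_cases a) => ->. Qed.

Lemma normr_signF2 (a : F2) : `|signF2 a| = 1.
Proof. by rewrite /signF2 normrX normrN1 expr1n. Qed.

Variables k m : nat.
Hypothesis k_gt0 : (0 < k)%N.
Local Notation ten := {ffun {ffun 'I_m.+1 -> 'I_k} -> F2}.

(** Orthogonality of characters: flipping the entry of [T] at an index where [w] has coordinate 1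
    negates every term. *)
Lemma sum_signF2_pairing (w : tensors k m.+1) :
  \sum_(T : ten) signF2 (pairing T w) = (#|{: ten}| * (w == 0))%:R.
Proof.
have [->|w_nz] := eqVneq w 0.
  rewrite muln1 -[RHS]mulr_natl mulr1 -sum1_card natr_sum; apply: eq_bigr => T _.
  by rewrite pairing0r /signF2 expr0.
pose c (i : {ffun 'I_m.+1 -> 'I_k}) := coords w (fun a => i (inord a)).
have [i wi] : exists i, c i = 1.
  have [i wi|w0] := pickP (fun i => c i != 0).
    by exists i; case: (F2_cases (c i)) wi => ->; rewrite ?eqxx.
  case/eqP: w_nz; apply: coords_eq0 => // g.
  have /negbFE/eqP <- := w0 [ffun a : 'I_m.+1 => g a].
  by apply: eq_coords => a am; rewrite ffunE inordK.
pose D : ten := [ffun j => (j == i)%:R].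
have DE : pairing D w = 1.
  rewrite /pairing (bigD1 i) // ffunE eqxx -/(c i) wi mulr1.
  rewrite big1 => [|j /negPf ji]; first exact: addr0.
  by rewrite ffunE ji mul0r.
rewrite muln0; set S := \sum_T _.
have : S = - S.
  rewrite {1}/S (reindex_inj (addIr D)) -sumrN; apply: eq_bigr => T _.
  by rewrite pairingDl signF2D DE {2}/signF2 expr1 mulrN1.
by move/eqP; rewrite -addr_eq0 -mulr2n mulrn_eq0 => /eqP.
Qed.

Variables (X : finType) (tau : X -> vectuple k m.+1) (g : X -> F2).
Hypothesis tau_inj : injective tau.

Definition signsum (T : ten) : R :=
  \sum_x signF2 (pairing T (rank_one (tau x)) - g x).

(** The general [w] makes the induction on t work: expanding one factor [signsum T] adds a rank one
    tensor to [w]. The values of [g] enter only as signs and vanish under absolute values. *)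
Lemma moment_le t (w : tensors k m.+1) :
  `|\sum_T signF2 (pairing T w) * signsum T ^+ t| <=
    (#|{: ten}| * hits t w 0)%:R.
Proof.
elim: t w => [|t IH] w.
  under eq_bigr do rewrite expr0 mulr1.
  rewrite sum_signF2_pairing normr_nat ler_nat leq_mul2l; apply/orP; right.
  have [->|//] := eqVneq w 0.
  by rewrite /= (_ : [forall j, _]) //; apply/forallP => j; rewrite ffunE mem0v.
have -> : \sum_T signF2 (pairing T w) * signsum T ^+ t.+1 =
    \sum_x signF2 (g x) *
      \sum_T signF2 (pairing T (w + rank_one (tau x))) * signsum T ^+ t.
  under [RHS]eq_bigr do rewrite mulr_sumr.
  rewrite exchange_big; apply: eq_bigr => T _.
  rewrite exprS mulrA [signF2 _ * _]mulr_sumr mulr_suml; apply: eq_bigr => x _.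
  by rewrite pairingDr !signF2D signF2N; ring.
apply: le_trans (ler_norm_sum _ _ _) _.
apply: (@le_trans _ _
  (\sum_x (#|{: ten}| * hits t (w + rank_one (tau x)) 0)%:R)).
  by apply: ler_sum => x _; rewrite normrM normr_signF2 mul1r.
rewrite -natr_sum ler_nat -big_distrr leq_mul2l; apply/orP; right.
(* Injectivity of [tau] makes the sum over x a part of the sum over all vector tuples in [hits]. *)
rewrite -(big_imset (fun u => hits t (w + rank_one u) 0) (in2W tau_inj)) /=.
by rewrite [leqRHS](bigID (mem [set tau x | x in X])) leq_addr.
Qed.

End Moments.

(** * Low degree polynomials as functions on F_2^n, and their number *)

Section LowDegree.
Variables n l : nat.

Definition small_sets : {set {set 'I_n}} :=
  [set S : {set 'I_n} | (#|S| <= l)%N].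

Definition monomial_sum (c : {set {set 'I_n}}) (x : 'rV[F2]_n) : F2 :=
  \sum_(S in c) \prod_(i in S) x 0 i.

Lemma exprF2 (b : F2) e : (0 < e)%N -> b ^+ e = b.
Proof.
by case: (F2_cases b) => -> e0; rewrite ?expr1n // expr0n -leqn0 leqNgt e0.
Qed.

(** Since b^e = b in F_2 for e > 0, monomials with the same support agree as functions, and their
    coefficients can be added up. *)
Lemma poly_fun_monomial_sum (P : mpoly.mpoly n F2) : degree_le l P ->
  exists2 c : {set {set 'I_n}},
    c \subset small_sets & poly_fun P =1 monomial_sum c.
Proof.
move=> degP; pose supp (m : mpoly.multinom n) := [set i | m i != 0%N].
pose C S := \sum_(m <- mpoly.msupp P | supp m == S) mpoly.mcoeff m P.
exists [set S in small_sets | C S != 0].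
  by apply/fintype.subsetP => S; rewrite inE => /andP[].
move=> x; rewrite /poly_fun mpoly.mevalE big_seq.
rewrite (partition_big supp (fun S => S \in small_sets)) /=; last first.
  move=> m /mpoly.msize_mdeg_lt mP; rewrite inE -ltnS.
  apply: leq_trans degP; apply: leq_ltn_trans mP.
  rewrite mpoly.mdegE -sum1_card big_mkcond; apply: leq_sum => i _.
  by rewrite inE; case: (m i).
rewrite /monomial_sum big_mkcond [RHS]big_mkcond; apply: eq_bigr => S _.
have -> : (S \in [set S in small_sets | C S != 0]) =
    (S \in small_sets) && (C S != 0).
  by rewrite inE.
case: (S \in small_sets) => //=.
apply: (@etrans _ _ (C S * \prod_(i in S) x 0 i)).
  rewrite /C mulr_suml [RHS]big_seq_cond; apply: eq_bigr => m /andP[_ /eqP <-].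
  congr (_ * _); rewrite [RHS]big_mkcond; apply: eq_bigr => i _; rewrite inE.
  by have [->//|m_gt0] := posnP (m i); rewrite exprF2 // -lt0n m_gt0.
by case: (F2_cases (C S)) => ->; rewrite ?mul0r ?mul1r.
Qed.

Lemma card_small_sets : #|small_sets| = (\sum_(j < l.+1) 'C(n, j))%N.
Proof.
rewrite -sum1_card.
rewrite (partition_big
  (fun S : {set 'I_n} => inord #|S|) (fun _ : 'I_l.+1 => true)) //.
apply: eq_bigr => j _; rewrite -[n in RHS]card_ord -card_draws -sum1_card.
apply: eq_bigl => S; rewrite !inE; apply/andP/eqP => [[Sl /eqP <-]|Sj].
  by rewrite inordK.
by rewrite Sj -ltnS ltn_ord inord_val.
Qed.

End LowDegree.

(** Bernoulli's inequality (1 - 1/(k+1))^h >= 1 - h/(k+1) without denominators. *)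
Lemma bernoulli_nat k h :
  (h <= k.+1 -> k.+1 ^ h * (k.+1 - h) <= k ^ h * k.+1)%N.
Proof.
elim: h => [|h IH] hk; first by rewrite !expn0 subn0.
have {}IH := IH (ltnW hk).
apply: (@leq_trans (k * (k.+1 ^ h * (k.+1 - h)))); last first.
  by rewrite expnS -[leqRHS]mulnA leq_mul2l IH orbT.
by rewrite expnS; have : (k.+1 * (k.+1 - h.+1) <= k * (k.+1 - h))%N; nia.
Qed.

(** Bernoulli with h about k/2 gives (1 + 1/k)^h <= 2, which is then squared. *)
Lemma expSn_le k : (0 < k)%N -> (k.+1 ^ k <= 4 * k ^ k)%N.
Proof.
move=> k_gt0; have [h hk kh] : exists2 h, (h.*2 <= k.+1)%N & (k <= h.*2)%N.
  by exists (uphalf k); lia.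
have le2 : (k.+1 ^ h <= 2 * k ^ h)%N.
  have := @bernoulli_nat k h ltac:(lia); move: (_ ^ h)%N (k ^ h)%N => a b ab.
  have : (a * k.+1 <= 2 * (a * (k.+1 - h)))%N by nia.
  by move=> ak; rewrite -(leq_pmul2r (ltn0Sn k)); nia.
have le4 : (k.+1 ^ h.*2 <= 4 * k ^ h.*2)%N.
  by rewrite -addnn !expnD; move: (_ ^ h)%N (k ^ h)%N le2 => a b; nia.
have [hE|ne] := eqVneq h.*2 k; first by rewrite hE in le4.
have e : h.*2 = k.+1 by apply/eqP; rewrite eqn_leq hk ltn_neqAle eq_sym ne.
move: le4; rewrite e !expnS => le4; rewrite -(leq_pmul2l (ltn0Sn k)).
by apply: leq_trans le4 _; nia.
Qed.

(** Comparison with the binomial expansion of (k + 1)^n, where n = k d, gives the bound 4^d k^l; its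
    square is at most (16 k)^d because 2 l < d. *)
Lemma card_small_sets_le k d l q : (0 < k)%N -> (l.*2 < d)%N ->
  (16 * k <= q ^ 2)%N -> (#|small_sets (k * d) l| <= q ^ d)%N.
Proof.
move=> k_gt0 ld qk; set s := #|_|; set n := (k * d)%N.
have ln : (l <= n)%N by rewrite /n; nia.
have le1 : (s * k ^ (n - l) <= k.+1 ^ n)%N.
  rewrite /s card_small_sets -/n -[k.+1]addn1 expnDn big_distrl /=.
  rewrite (big_ord_widen n.+1 (fun j => 'C(n, j) * k ^ (n - l)))%N ?ltnS //.
  rewrite big_mkcond; apply: leq_sum => j _; case: ifP => // jl.
  by rewrite exp1n muln1 leq_mul2l leq_pexp2l ?orbT //; lia.
have le2 : (s <= 4 ^ d * k ^ l)%N.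
  rewrite -(@leq_pmul2r (k ^ (n - l))) ?expn_gt0 ?k_gt0 // -mulnA -expnD.
  rewrite subnKC //; apply: leq_trans le1 _.
  rewrite /n [leqRHS]mulnC !expnM -expnMn mulnC.
  by rewrite leq_exp2r ?expSn_le //; lia.
rewrite -(@leq_exp2r _ _ 2) //; apply: (@leq_trans ((4 ^ d * k ^ l) ^ 2)).
  by rewrite leq_exp2r.
have -> : ((q ^ d) ^ 2 = (q ^ 2) ^ d)%N by rewrite -!expnM mulnC.
have -> : ((4 ^ d * k ^ l) ^ 2 = 16 ^ d * k ^ l.*2)%N.
  by rewrite -[16%N]/(4 ^ 2)%N expnMn -!expnM -muln2 [(d * 2)%N]mulnC.
apply: (@leq_trans ((16 * k) ^ d)); last by rewrite leq_exp2r //; lia.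
by rewrite expnMn leq_mul2l leq_pexp2l ?orbT //; lia.
Qed.

Lemma leq_card_bigcup (I T : finType) (P : pred I) (A : I -> {set T}) :
  (#|\bigcup_(i | P i) A i| <= \sum_(i | P i) #|A i|)%N.
Proof.
elim/big_rec2: _ => [|i s B _ leB]; first by rewrite cards0.
by apply: leq_trans (leq_card_setU _ _) _; rewrite leq_add2l.
Qed.

(** * Markov's inequality and the union bound for fixed n and d *)

Section FiniteBound.
Variables (R : realDomainType) (n m q : nat).
Local Notation d := m.+1.
Local Notation k := (n %/ d)%N.
Hypotheses (d_dvd_n : (d %| n)%N) (k_gt0 : (0 < k)%N).
Local Notation ten := {ffun {ffun 'I_d -> 'I_k} -> F2}.

Definition point_of (x : 'rV[F2]_n) : vectuple k d :=
  pack d (fun a => block x (inord a)).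

Lemma point_of_inj : injective point_of.
Proof.
move=> x y /pack_inj xy; apply/rowP => i.
have ia : (i %/ k < d)%N by rewrite ltn_divLR // mulnC divnK.
have ij : (i %% k < k)%N by rewrite ltn_mod.
have := xy _ ia; move/rowP/(_ (Ordinal ij)); rewrite !mxE.
suff -> : block_index (inord (i %/ k)) (Ordinal ij) = i by [].
by apply/val_inj; rewrite /= inordK // -divn_eq.
Qed.

Lemma mlform_fun_pairing (T : ten) x :
  mlform_fun (T : tensor k d) x = pairing T (rank_one (point_of x)).
Proof.
apply: eq_bigr => i _; rewrite coords_rank_one; congr (_ * _).
by apply: eq_bigr => a _; rewrite inord_val.
Qed.

Definition corrsum (g : 'rV[F2]_n -> F2) (T : ten) : R :=
  \sum_x signF2 R (mlform_fun (T : tensor k d) x - g x).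

Lemma corrsum_moment_le g t : (t <= q ^ m)%N ->
  \sum_T corrsum g T ^+ t <=
    (#|{: ten}| * (d * 2 ^ q * 2 ^ (k * m)) ^ t)%:R.
Proof.
move=> tq; apply: le_trans (ler_norm _) _.
have := moment_le R k_gt0 g point_of_inj t 0.
under eq_bigr => T _.
  rewrite pairing0r [signF2 _ _]expr0 mul1r /signsum.
  under eq_bigr do rewrite -mlform_fun_pairing.
  over.
move=> /le_trans; apply; rewrite ler_nat leq_mul2l; apply/orP; right.
by apply: hits_le; rewrite dimv0.
Qed.

Hypotheses (q_gt0 : (0 < q)%N) (q_even : ~~ odd q) (d_le : (d <= 2 ^ q)%N).

(** Markov's inequality for the moment of order t = q^m, which is even, so the signed sum may
    replace its absolute value. The threshold beats the base 2^b of the moment bound by 2^(2 q), and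
    (2^(2 q))^t = 2^(2 q^d). *)
Lemma few_correlated_with g : (0 < m)%N ->
  (#|[set T | ((2 ^ (k * m + 4 * q))%:R <= `|corrsum g T|)%R]| *
     2 ^ (q ^ d).*2 <= #|{: ten}|)%N.
Proof.
move=> m_gt0; set E := [set T | _].
pose t := (q ^ m)%N; pose b := (k * m + 2 * q)%N.
have t_even : ~~ odd t by rewrite oddX negb_or q_even andbT -lt0n.
have E_moment : (#|E| * (2 ^ (b + 2 * q)) ^ t <= #|{: ten}| * (2 ^ b) ^ t)%N.
  rewrite -(ler_nat R); apply: (@le_trans _ _ (\sum_T corrsum g T ^+ t)).
    rewrite natrM mulr_natl -sumr_const big_mkcond; apply: ler_sum => T _.
    case: ifP => [|_]; last by rewrite real_exprn_even_ge0 ?num_real.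
    have -> : corrsum g T ^+ t = `|corrsum g T| ^+ t.
      by rewrite -normrX ger0_norm // real_exprn_even_ge0 ?num_real.
    rewrite inE => ET; rewrite natrX; apply: lerXn2r; rewrite ?nnegrE //.
    by apply: le_trans ET; rewrite ler_nat leq_exp2l // /b; lia.
  apply: le_trans (corrsum_moment_le _ (leqnn _)) _.
  rewrite ler_nat leq_mul2l; apply/orP; right.
  rewrite leq_exp2r ?expn_gt0 ?q_gt0 //.
  rewrite /b addnC mul2n -addnn !expnD leq_mul2r; apply/orP; right.
  by rewrite leq_mul2r d_le orbT.
have : (#|E| * (2 ^ (2 * q)) ^ t <= #|{: ten}|)%N.
  rewrite -(@leq_pmul2r ((2 ^ b) ^ t)) ?expn_gt0 // -mulnA -expnMn -expnD.
  by rewrite [(2 * q + b)%N]addnC.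
by rewrite -expnM /t -mulnA -expnS mul2n.
Qed.

(* For d = 1 the exponent t = q^(d-1) = 1 is odd, but then f_T is linear and its
   correlation with a constant is 0 unless f_T = 0. *)
Lemma few_correlated_with_constant : m = 0%N -> (2 * q <= k)%N ->
  (#|[set T | (corrsum (fun=> 0) T != 0)%R]| * 2 ^ q <= #|{: ten}|)%N.
Proof.
move=> m0 qk; set E := [set T | _].
have mlform_funD T x y : mlform_fun (T : tensor k d) (x + y) =
    mlform_fun (T : tensor k d) x + mlform_fun (T : tensor k d) y.
  have prodE (F : 'I_d -> F2) : \prod_(a < d) F a = F ord0.
    by move: F; rewrite m0 => F; rewrite big_ord1.
  rewrite -big_split; apply: eq_bigr => i _; rewrite /= -mulrDr !prodE.
  by rewrite !mxE.
have corrsumE T : corrsum (fun=> 0) T = (if T \in E then (2 ^ n)%:R else 0).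
  rewrite inE; have [//|nz] := eqVneq.
  have f0 x : mlform_fun (T : tensor k d) x = 0.
    case: (F2_cases (mlform_fun (T : tensor k d) x)) => // fx; case/eqP: nz.
    set S := corrsum _ _; have : S = - S.
      rewrite {1}/S /corrsum (reindex_inj (addIr x)) -sumrN.
      apply: eq_bigr => y _.
      by rewrite !subr0 mlform_funD fx signF2D {2}/signF2 expr1 mulrN1.
    by move/eqP; rewrite -addr_eq0 -mulr2n mulrn_eq0 => /eqP.
  rewrite /corrsum (eq_bigr (fun=> 1)) => [|x _].
    by rewrite sumr_const card_mx card_Fp // mul1n.
  by rewrite f0 subr0 /signF2 expr0.
(* The first moment is exactly #|E| 2^n, so #|E| 2^n <= 2^q #|ten|, and 2 q <= k <= n suffices. *)
have := @corrsum_moment_le (fun=> 0) 1 ltac:(by rewrite expn_gt0 q_gt0).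
under eq_bigr => T _ do rewrite expr1 corrsumE.
have -> : (d * 2 ^ q * 2 ^ (k * m) = 2 ^ q)%N by rewrite m0 muln0 muln1 mul1n.
rewrite -big_mkcond sumr_const -mulrnA ler_nat expn1 => le1.
rewrite -(@leq_pmul2r (2 ^ q)) ?expn_gt0 //; apply: leq_trans le1.
rewrite -mulnA -expnD mulnC leq_mul2r leq_exp2l // addnn -mul2n.
by rewrite (leq_trans qk (leq_div _ _)) orbT.
Qed.

(** For d = 1 the degree bound is l = 0, and a constant only changes the sign. Otherwise at most
    2^(q^d) functions are each correlated with a fraction at most 2^(-2 q^d) of the forms, which
    leaves 2^(-q^d) <= 2^-q. *)
Lemma few_correlated l (E : {set ten}) : (l.*2 < d)%N ->
  (16 * k <= q ^ 2)%N -> (2 * q <= k)%N ->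
  (forall T, T \in E -> exists2 P, degree_le l P &
     (2 ^ (k * m + 4 * q))%:R <= `|corrsum (poly_fun P) T|) ->
  (#|E| * 2 ^ q <= #|{: ten}|)%N.
Proof.
move=> ld kq qk bad; have [m0|m_gt0] := posnP m.
  apply: leq_trans (few_correlated_with_constant m0 qk); rewrite leq_mul2r.
  apply/orP; right; apply/subset_leq_card/fintype.subsetP => T /bad[P degP TP].
  rewrite inE; apply: contraTneq TP => corr0.
  have l0 : l = 0%N by lia.
  move: degP; rewrite /degree_le l0 => /mpoly.msize1_polyC ->.
  set c := mpoly.mcoeff _ _.
  suff -> : corrsum (poly_fun (mpoly.mpolyC n c)) T =
      signF2 R c * corrsum (fun=> 0) T.
    by rewrite corr0 mulr0 normr0 -ltNge ltr0n expn_gt0.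
  rewrite mulr_sumr; apply: eq_bigr => x _.
  by rewrite /poly_fun mpoly.mevalC signF2D subr0 signF2N mulrC.
pose Ec c :=
  [set T | (2 ^ (k * m + 4 * q))%:R <= `|corrsum (monomial_sum c) T|].
have EEc : E \subset \bigcup_(c in powerset (small_sets n l)) Ec c.
  apply/fintype.subsetP => T /bad[P /poly_fun_monomial_sum[c cl Pc] TP].
  apply/bigcupP; exists c; rewrite inE //; congr (_ <= `|_|): TP.
  by apply: eq_bigr => x _; rewrite Pc.
have cardS : (#|small_sets n l| <= q ^ d)%N.
  by rewrite -(divnK d_dvd_n) card_small_sets_le.
have : (#|E| * 2 ^ (q ^ d).*2 <= 2 ^ (q ^ d) * #|{: ten}|)%N.
  apply: (@leq_trans
      (\sum_(c in powerset (small_sets n l)) #|Ec c| * 2 ^ (q ^ d).*2)).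
    rewrite -big_distrl leq_mul2r; apply/orP; right.
    by apply: leq_trans (subset_leq_card EEc) (leq_card_bigcup _ _).
  apply: (@leq_trans (\sum_(c in powerset (small_sets n l)) #|{: ten}|)).
    by apply: leq_sum => c _; apply: few_correlated_with.
  rewrite sum_nat_const card_powerset leq_mul2r; apply/orP; right.
  by rewrite leq_exp2l.
rewrite -addnn expnD mulnCA leq_pmul2l ?expn_gt0 //; apply: leq_trans.
by rewrite leq_mul2l leq_exp2l // -[leqLHS]expn1 leq_pexp2l ?orbT.
Qed.

End FiniteBound.

(** * From counts to probabilities and correlations *)

Local Open Scope classical_set_scope.
Local Open Scope ring_scope.

Lemma Pr_small_Corr_ge (R : realType) (n d l q : nat) :
  (d %| n)%N -> (0 < n %/ d)%N -> (l.*2 < d)%N ->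
  (0 < q)%N -> ~~ odd q -> (d <= 2 ^ q)%N ->
  (16 * (n %/ d) <= q ^ 2)%N -> (2 * q <= n %/ d)%N ->
  1 - q%:R^-1 <= Pr_unif R (fun T : tensor (n %/ d) d =>
    forall P : mpoly.mpoly n F2, degree_le l P ->
      Corr R (mlform_fun T) (poly_fun P) <
        2 `^ (- ((1 - (4 * q)%:R / (n %/ d)%:R) * (n%:R / d%:R)))).
Proof.
case: d => [|m] // dn k_gt0 ld q_gt0 q_even dq kq qk.
set k := (n %/ m.+1)%N in k_gt0 kq qk *.
set Good := (fun T : tensor k m.+1 => _).
pose E := finset (fun T : tensor k m.+1 => ~~ `[< Good T >]).
have nE : n = (k * m + k)%N by rewrite -mulnSr divnK.
have cardE : (#|E| * 2 ^ q <= #|tensor k m.+1|)%N.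
  refine (@few_correlated R n m q dn k_gt0 q_gt0 q_even dq l E ld kq qk _) => T.
  rewrite inE => /asboolPn /existsNP[P /not_implyP[degP /negP]].
  rewrite -leNgt => TP; exists P => //; move: TP.
  (* As n = k m + k, the threshold 2^(k m + 4 q) for the sum is 2^(4 q - k) after division by
     2^n. *)
  set p := 2 `^ _; have -> : p = (2 ^ (k * m + 4 * q))%:R / (2 ^ n)%:R.
    have k_neq0 : k%:R != 0 :> R by rewrite pnatr_eq0 -lt0n.
    have m_neq0 : m.+1%:R != 0 :> R by rewrite pnatr_eq0.
    have -> : p = 2 `^ ((k * m + 4 * q)%:R - n%:R).
      rewrite /p; congr (_ `^ _).
      have -> : n%:R / m.+1%:R = k%:R :> R.
        by rewrite -[n in LHS](divnK dn) natrM mulfK.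
      by rewrite nE !natrD; field.
    by rewrite powRD ?pnatr_eq0 ?implybT // powRN !powR_mulrn // !natrX.
  rewrite /Corr /bias normrM normfV card_mx card_Fp // mul1n normr_nat.
  by rewrite ler_pM2r // invr_gt0 ltr0n expn_gt0.
have T_gt0 : (0 < #|tensor k m.+1|)%N by apply/card_gt0P; exists 0.
have -> : Pr_unif R Good = 1 - #|E|%:R / #|tensor k m.+1|%:R.
  have T_neq0 : #|tensor k m.+1|%:R != 0 :> R by rewrite pnatr_eq0 -lt0n.
  rewrite /Pr_unif -[X in X - _](divff T_neq0) -mulrBl; congr (_ / _).
  set G := [pred w | _]; have -> : #|E| = #|[predC G]|.
    by apply: eq_card => T; rewrite !inE.
  by rewrite -(cardC G) natrD addrK.
rewrite lerD2l lerN2 ler_pdivrMr ?ltr0n // ler_pdivlMl ?ltr0n // -natrM ler_nat.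
apply: leq_trans cardE; rewrite mulnC leq_mul2l; apply/orP; right.
by apply/ltnW/ltn_expl.
Qed.

(** * Growth of k = n / d and of the loss q *)

Section Asymptotics.
Variables (R : realType) (n d : nat -> nat).
Hypotheses (n_oo : n t @[t --> \oo] --> \oo)
  (d_dvd_n : forall t, (d t %| n t)%N) (d_gt0 : forall t, (0 < d t)%N)
  (d_small : (fun t => (d t)%:R : R^o) =o_\oo
             (fun t => (n t)%:R / ln (n t)%:R : R^o)).
Let k t := (n t %/ d t)%N.

(** Substituting n = k d in d = o(n / ln n) and cancelling d gives ln n = o(k). *)
Lemma near_ln_le (e : R) : 0 < e ->
  \forall t \near \oo, ln (n t)%:R <= e * (k t)%:R.
Proof.
move=> e_gt0; have /eqoP /(_ e e_gt0) ode := d_small.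
have /cvgnyPge /(_ 3%N) n_ge3 := n_oo.
near=> t.
have n3 : (3 <= n t)%N by near: t.
have : `|(d t)%:R| <= e * `|(n t)%:R / ln (n t)%:R| :> R by near: t.
have ln_n_gt0 : 0 < ln (n t)%:R :> R by apply: ln_gt0; rewrite ltr1n; lia.
rewrite !ger0_norm ?divr_ge0 ?ler0n ?(ltW ln_n_gt0) //.
have nE : (n t)%:R = (k t)%:R * (d t)%:R :> R by rewrite -natrM divnK.
have d_gt0R : 0 < (d t)%:R :> R by rewrite ltr0n.
rewrite mulrA ler_pdivlMr // nE mulrC mulrA => le1.
by rewrite -(ler_pM2r d_gt0R).
Unshelve. all: by end_near. Qed.

Lemma near_k_ge (M : R) : \forall t \near \oo, M <= (k t)%:R.
Proof.
have /cvgnyPge /(_ (Num.truncn (expR M)).+1) n_ge := n_oo.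
near=> t.
have ln_le : ln (n t)%:R <= 1 * (k t)%:R :> R by near: t; apply: near_ln_le.
have : (Num.truncn (expR M) < n t)%N by near: t.
rewrite -(ler_nat R) => /(lt_le_trans (truncnS_gt _)) nM.
rewrite mul1r in ln_le; apply: le_trans ln_le.
by rewrite -[M]expRK ler_ln ?posrE ?expR_gt0 ?ltW // (lt_trans (expR_gt0 M)).
Unshelve. all: by end_near. Qed.

(* The exponent q of the header, so that the correlation bound is 2^(4 q - k). *)
Definition loss t :=
  (4 * (Num.truncn (Num.sqrt (k t)%:R : R)).+1 + 2 * (trunc_log 2 (n t)).+1)%N.

Lemma loss_even t : ~~ odd (loss t).
Proof. by rewrite /loss; lia. Qed.

Lemma loss_gt0 t : (0 < loss t)%N.
Proof. by rewrite /loss; lia. Qed.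

Lemma d_le_loss t : (0 < n t)%N -> (d t <= 2 ^ loss t)%N.
Proof.
move=> n_gt0; apply: leq_trans (dvdn_leq n_gt0 (d_dvd_n t)) _.
apply: leq_trans (ltnW (trunc_log_ltn (n t) (isT : 1 < 2)%N)) _.
by rewrite leq_exp2l // /loss; lia.
Qed.

Lemma loss_sqr t : (16 * k t <= loss t ^ 2)%N.
Proof.
have : (k t <= (Num.truncn (Num.sqrt (k t)%:R : R)).+1 ^ 2)%N.
  rewrite -(ler_nat R) natrX -[leLHS]sqr_sqrtr ?ler0n //.
  rewrite lerXn2r ?nnegrE ?sqrtr_ge0 //.
  exact/ltW/truncnS_gt.
by rewrite /loss; nia.
Qed.

Lemma near_loss_le (e : R) : 0 < e ->
  \forall t \near \oo, (loss t)%:R <= e * (k t)%:R.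
Proof.
(* With sqrt k, ln n and 1 each at most b k and log_2 n <= 2 ln n, the loss is at most (4 + 4 + 4 +
   2) b k. *)
move=> e_gt0; pose b := e / 14%:R; have b_gt0 : 0 < b by rewrite divr_gt0.
have /cvgnyPge /(_ 1%N) n_ge1 := n_oo.
near=> t.
have kb : b^-1 ^+ 2 <= (k t)%:R by near: t; apply: near_k_ge.
have kb1 : b^-1 <= (k t)%:R by near: t; apply: near_k_ge.
have lnb : ln (n t)%:R <= b * (k t)%:R by near: t; apply: near_ln_le.
have n_gt0 : (0 < n t)%N by near: t.
have sqrtb : Num.sqrt (k t)%:R <= b * (k t)%:R :> R.
  rewrite -[X in b * X]sqr_sqrtr ?ler0n // expr2 mulrA -[leLHS]mul1r.
  rewrite ler_wpM2r ?sqrtr_ge0 // -ler_pdivrMl // mulr1.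
  rewrite -(@ger0_norm _ b^-1) ?invr_ge0 ?(ltW b_gt0) // -sqrtr_sqr.
  exact: ler_wsqrtr.
have logb : (trunc_log 2 (n t))%:R <= 2 * ln (n t)%:R :> R.
  (* This is exp(-1/2) >= 1 - 1/2, inverted. *)
  have ln2 : 2^-1 <= ln 2 :> R.
    rewrite -[leLHS]expRK ler_ln ?posrE ?expR_gt0 // -[leRHS]invrK.
    rewrite -[X in expR X]opprK expRN lef_pV2 ?posrE ?expR_gt0 ?invr_gt0 //.
    by have := expR_ge1Dx (- 2^-1 : R); lra.
  have := trunc_logP (isT : 1 < 2)%N n_gt0.
  rewrite -(ler_nat R) natrX => le2.
  have : ln (2 ^+ trunc_log 2 (n t)) <= ln (n t)%:R :> R.
    by rewrite ler_ln ?posrE ?ltr0n ?exprn_gt0.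
  rewrite lnXn // -[ln 2 *+ _]mulr_natr.
  by have := ler_wpM2r (ler0n R (trunc_log 2 (n t))) ln2; lra.
have truncb := truncn_le (Num.sqrt (k t)%:R : R); rewrite sqrtr_ge0 in truncb.
have bk1 : 1 <= b * (k t)%:R by rewrite -ler_pdivrMl // mulr1.
have -> : e * (k t)%:R = 14%:R * (b * (k t)%:R) by rewrite /b; field.
rewrite /loss natrD !natrM -!natr1.
by move: (b * _) sqrtb logb truncb lnb bk1 => *; lra.
Unshelve. all: by end_near. Qed.

End Asymptotics.

(* The limit n -> oo is taken along an arbitrary sequence n_0, n_1, ... tending
   to infinity, since d | n and d = o(n / log n) can force d = 1 (for prime n);
   the identity sequence gives the limit along all n. *)
Theorem theorem3p1 (R : realType) (n d l : nat -> nat)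
    (n_oo : n t @[t --> \oo] --> \oo)
    (d_dvd_n : forall t, (d t %| n t)%N)
    (d_small : (fun t => (d t)%:R : R^o) =o_\oo
               (fun t => (n t)%:R / ln (n t)%:R : R^o))
    (l_lt_d2 : forall t, ((l t)%:R : R) < (d t)%:R / 2) :
  exists eps : nat -> R,
    eps t @[t --> \oo] --> (0 : R) /\
    Pr_unif R (fun T : tensor (n t %/ d t) (d t) =>
      forall P : mpoly.mpoly (n t) 'F_2, degree_le (l t) P ->
        Corr R (mlform_fun T) (poly_fun P)
          < 2 `^ (- ((1 - eps t) * ((n t)%:R / (d t)%:R))))
      @[t --> \oo] --> (1 : R).
Proof.
have l2_lt_d t : ((l t).*2 < d t)%N.
  by have := l_lt_d2 t; rewrite ltr_pdivlMr // -natrM ltr_nat muln2.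
have d_gt0 t : (0 < d t)%N by apply: leq_ltn_trans (l2_lt_d t).
pose q := loss R n d; pose k t := (n t %/ d t)%N.
have q_le := near_loss_le n_oo d_dvd_n d_gt0 d_small.
have k_ge := near_k_ge n_oo d_dvd_n d_gt0 d_small.
have /cvgnyPge /(_ 1%N) n_gt0 := n_oo.
(* The correlation bound 2^(4 q - k) dictates this choice; it tends to 0 because q = o(k). *)
exists (fun t => (4 * q t)%:R / (k t)%:R); split.
  apply/cvgr0Pnorm_le => e e_gt0; near=> t.
  have k_gt0 : 1 <= (k t)%:R :> R by near: t; apply: k_ge.
  have qk : (q t)%:R <= e / 4 * (k t)%:R.
    by near: t; apply: q_le; rewrite divr_gt0.
  rewrite ger0_norm ?divr_ge0 // ler_pdivrMr; last exact: lt_le_trans k_gt0.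
  by rewrite natrM; lra.
apply/cvgrPdist_le => e e_gt0; near=> t.
have k_gt0 : 1 <= (k t)%:R :> R by near: t; apply: k_ge.
(* Together with q^2 >= 16 k this makes the failure probability 1/q at most e. *)
have ke : e^-1 ^+ 2 <= (k t)%:R by near: t; apply: k_ge.
have qk : (2 * q t <= k t)%N.
  by rewrite -(ler_nat R) natrM -ler_pdivlMl //; near: t; apply: q_le.
have qe : (q t)%:R^-1 <= e.
  have : e^-1 <= (q t)%:R.
    rewrite -(@ler_pXn2r _ 2) ?nnegrE ?invr_ge0 ?(ltW e_gt0) //.
    rewrite (le_trans ke) // -natrX ler_nat.
    by apply: leq_trans (loss_sqr R n d t); rewrite leq_pmull.
  by move=> qe; rewrite -[e]invrK lef_pV2 ?posrE ?invr_gt0 ?ltr0n ?loss_gt0.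
have dq : (d t <= 2 ^ q t)%N by apply: d_le_loss => //; near: t.
rewrite ler1n in k_gt0.
have := @Pr_small_Corr_ge R (n t) (d t) (l t) (q t) (d_dvd_n t) k_gt0
  (l2_lt_d t) (loss_gt0 R n d t) (loss_even R n d t) dq (loss_sqr R n d t) qk.
set p := Pr_unif _ _ => p_ge.
have p_le1 : p <= 1.
  rewrite ler_pdivrMr ?mul1r ?ler_nat ?max_card // ltr0n.
  by apply/card_gt0P; exists 0.
by rewrite ger0_norm ?subr_ge0 //; lra.
Unshelve. all: by end_near. Qed.
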